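(* For $n\ge2$, $$2\widetilde C_n(t)=\widetilde B_n(t)+2nt\,C_{n-1}(t).$$
   Context: The Weyl groups $B_n=C_n$ are the group of signed permutations: permutations $w$ of $\{\pm1,\dots,\pm n\}$ with $w(-i)=-w(i)$, written $w=w_1\cdots w_n$ with $w_i=w(i)$; set $w_0=0$. The number of ordinary descents is $d(w)=|\{i\in\{1,\dots,n\}:w_{i-1}>w_i\}|$, and $C_n(t)=\sum_{w\in C_n}t^{d(w)}$ is the ordinary Eulerian polynomial. The numbers of affine descents in types $C$ and $B$ are, respectively, $\widetilde d_C(w)=d(w)+1$ if $w_n>0$ and $d(w)$ otherwise; $\widetilde d_B(w)=d(w)+1$ if $w_{n-1}+w_n>0$ and $d(w)$ otherwise. The affine Eulerian polynomials are $\widetilde C_n(t)=\sum_{w\in C_n}t^{\widetilde d_C(w)}$ and $\widetilde B_n(t)=\sum_{w\in B_n}t^{\widetilde d_B(w)}$. *)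

(* Defs.v *)
From HB Require Import structures.
From mathcomp Require Import all_boot all_order all_algebra all_fingroup.

Set Implicit Arguments.
Unset Strict Implicit.
Unset Printing Implicit Defensive.

Import Order.TTheory GRing.Theory Num.Theory.
Local Open Scope ring_scope.

(* The set {1, ..., n, -1, ..., -n}: (i, false) stands for i + 1 and
   (i, true) for -(i + 1), since ordinals are numbered from 0. *)
Definition letter (n : nat) : finType := ('I_n * bool)%type.

Definition letter_val (n : nat) (a : letter n) : int :=
  if a.2 then - (a.1.+1)%:Z else (a.1.+1)%:Z.

Definition letter_opp (n : nat) (a : letter n) : letter n := (a.1, ~~ a.2).

Lemma letter_val_inj (n : nat) : injective (@letter_val n).
Proof.
move=> [i b] [j c]; rewrite /letter_val /=.
by case: b; case: c => // /eqP; rewrite ?eqr_opp eqz_nat eqSS => /eqP/val_inj->.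
Qed.

Lemma letter_val_opp (n : nat) (a : letter n) :
  letter_val (letter_opp a) = - letter_val a.
Proof. by case: a => i []; rewrite /letter_val /= ?opprK. Qed.

(* The common underlying set of the Weyl groups B_n = C_n. *)
Definition signed_perms (n : nat) : {set {perm letter n}} :=
  [set w : {perm letter n} | [forall a, w (letter_opp a) == letter_opp (w a)]].

(* w_i for 0 <= i <= n, with w_0 = 0; the value 0 for i > n is junk. *)
Definition entry (n : nat) (w : {perm letter n}) (i : nat) : int :=
  if i is j.+1 then
    if insub j : option 'I_n is Some k then letter_val (w (k, false)) else 0
  else 0.

(* The ordinal i : 'I_n stands for the position i + 1 in {1, ..., n}. *)
Definition des (n : nat) (w : {perm letter n}) : nat :=
  #|[set i : 'I_n | entry w i.+1 < entry w i]|.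

Definition affine_desC (n : nat) (w : {perm letter n}) : nat :=
  if 0 < entry w n then (des w).+1 else des w.

Definition affine_desB (n : nat) (w : {perm letter n}) : nat :=
  if 0 < entry w n.-1 + entry w n then (des w).+1 else des w.

Definition eulerianC (n : nat) : {poly int} :=
  \sum_(w in signed_perms n) 'X^(des w).

Definition affine_eulerianC (n : nat) : {poly int} :=
  \sum_(w in signed_perms n) 'X^(affine_desC w).

Definition affine_eulerianB (n : nat) : {poly int} :=
  \sum_(w in signed_perms n) 'X^(affine_desB w).

(* Main.v *)
Require Import Defs.
From mathcomp Require Import all_boot all_order all_algebra all_fingroup.
From mathcomp Require Import zify ring.

Set Implicit Arguments.
Unset Strict Implicit.
Unset Printing Implicit Defensive.

Import GRing.Theory.
Local Open Scope ring_scope.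

(** Negating the last letter [b = w_n] is an involution on signed permutations.
    Let [a = w_(n-1)], with [|a| <> |b|], and let [D] be the number of descents of
    [w] before its last position.  Adding [2 t^(d_C) - t^(d_B)] for [w] and for its
    image under the involution gives [2 t^(D+1)] in every case, so
    [2 C~_n - B~_n] is the sum of [t^(D+1)] over all [w].  Choosing [w_n] in one of
    [2 n] ways and standardizing [w_1 ... w_(n-1)], which preserves all comparisons,
    turns this sum into [2 n t C_(n-1)]. *)

(** Taking [m = n] gives [des w], and [m = n - 1] gives the number [D]; as a sum over ['I_m] it lets
    the last position be split off. *)
Definition prefix_des (n m : nat) (w : {perm letter n}) : nat :=
  (\sum_(i < m) (entry w i.+1 < entry w i)%R)%N.

Lemma des_prefix (n : nat) (w : {perm letter n}) : des w = prefix_des n w.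
Proof.
rewrite /des /prefix_des -sum1_card big_mkcond; apply: eq_bigr => i _.
by rewrite inE; case: (_ < _)%R.
Qed.

Lemma entryE (n : nat) (w : {perm letter n}) (k : 'I_n) :
  entry w k.+1 = letter_val (w (k, false)).
Proof. by rewrite /entry valK. Qed.

Lemma letter_val_neq0 (n : nat) (a : letter n) : letter_val a != 0.
Proof. by case: a => i []; rewrite /letter_val /=; lia. Qed.

Lemma abs_letter_val (n : nat) (a : letter n) : `|letter_val a|%N = a.1.+1.
Proof. by case: a => i []; rewrite /letter_val /=; lia. Qed.

Lemma signed_permsP (n : nat) (w : {perm letter n}) :
  reflect (forall a, w (letter_opp a) = letter_opp (w a)) (w \in signed_perms n).
Proof. by rewrite inE; apply: (iffP forallP) => H a; apply/eqP/H. Qed.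

(** Letters with the same absolute value are equal or opposite, and [w] commutes with
    [letter_opp]. *)
Lemma signed_perm_fst_inj {n : nat} {w : {perm letter n}} (a b : letter n) :
  w \in signed_perms n -> (w a).1 = (w b).1 -> a.1 = b.1.
Proof.
move=> /signed_permsP Hw E.
have [/perm_inj-> //|ne] := eqVneq (w a) (w b).
suff /perm_inj -> : w a = w (letter_opp b) by [].
rewrite Hw; move: E ne.
case: (w a) (w b) => [i s] [j t] /= ->; rewrite xpair_eqE eqxx /letter_opp /=.
by case: s; case: t.
Qed.

(** Products of permutations apply the left factor first, so the transposition acts on positions. *)
Definition flip_last (m : nat) (w : {perm letter m.+1}) : {perm letter m.+1} :=
  (tperm (ord_max, false) (ord_max, true) * w)%g.

Lemma flip_lastK (m : nat) : involutive (@flip_last m).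
Proof. by move=> w; rewrite /flip_last mulgA tperm2 mul1g. Qed.

Lemma flip_last_signed (m : nat) (w : {perm letter m.+1}) :
  (flip_last w \in signed_perms m.+1) = (w \in signed_perms m.+1).
Proof.
have imp v : v \in signed_perms m.+1 -> flip_last v \in signed_perms m.+1.
  move=> /signed_permsP Hv; apply/signed_permsP => -[i s]; rewrite !permM -Hv.
  congr (v _); rewrite /letter_opp /=.
  have [->|ne] := eqVneq i ord_max; first by case: s; rewrite /= ?tpermL ?tpermR.
  by rewrite !tpermD //= xpair_eqE negb_and eq_sym ne.
by apply/idP/idP => [/imp|/imp //]; rewrite flip_lastK.
Qed.

Lemma entry_flip_last (m : nat) (w : {perm letter m.+1}) (i : nat) :
  (i <= m)%N -> entry (flip_last w) i = entry w i.
Proof.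
case: i => // i lt_im.
rewrite -[i]/(nat_of_ord (Ordinal (ltnW lt_im : i < m.+1)%N)) !entryE permM tpermD //.
all: by rewrite xpair_eqE negb_and -val_eqE /= neq_ltn lt_im orbT.
Qed.

Lemma entry_flip_last_max (m : nat) (w : {perm letter m.+1}) :
  w \in signed_perms m.+1 -> entry (flip_last w) m.+1 = - entry w m.+1.
Proof.
move=> /signed_permsP Hw.
by rewrite !(@entryE _ _ ord_max) permM tpermL -letter_val_opp -Hw.
Qed.

Lemma abs_entry_last_neq (m : nat) (w : {perm letter m.+1}) :
  w \in signed_perms m.+1 -> `|entry w m|%N != `|entry w m.+1|%N.
Proof.
move=> Hw; rewrite (@entryE _ w ord_max) abs_letter_val.
(* For [m = 0] the left side is the convention [w_0 = 0]. *)
case: m w Hw => [//|m] w Hw.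
rewrite -[X in entry w X.+1]/(nat_of_ord (Ordinal (leqnSn m.+1))) entryE abs_letter_val.
by rewrite eqSS; apply/eqP => /val_inj/(signed_perm_fst_inj Hw) /= /(congr1 val) /=; lia.
Qed.

(** By symmetry let [b > 0]. The defects of [w] and its image are both [t^(D+1)] if [|a| < b]; they
    are [t^(D+2)] and [2 t^(D+1) - t^(D+2)] if [a > b], and [2 t^(D+1) - t^D] and [t^D] if
    [a < -b]. *)
Lemma affine_defect_flip (m : nat) (w : {perm letter m.+1}) :
  w \in signed_perms m.+1 ->
  let defect v := 2%:R * 'X^(affine_desC v) - 'X^(affine_desB v) : {poly int} in
  defect w + defect (flip_last w) = 2%:R * ('X * 'X^(prefix_des m w)).
Proof.
move=> Hw /=; have := abs_entry_last_neq Hw.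
have : entry w m.+1 != 0 by rewrite (@entryE _ w ord_max) letter_val_neq0.
have desE (v : {perm letter m.+1}) : des v = (prefix_des m v + (entry v m.+1 < entry v m)%R)%N.
  by rewrite des_prefix /prefix_des big_ord_recr.
rewrite /affine_desC /affine_desB !desE [m.+1.-1]succnK.
rewrite !entry_flip_last_max // !entry_flip_last //.
have -> : prefix_des m w = prefix_des m (flip_last w).
  by apply: eq_bigr => i _; rewrite !entry_flip_last // ltnW.
move: (entry w m) (entry w m.+1) (prefix_des _ _) => a b D b0 ab.
(* Three comparisons for [b] and three for [-b]; [lia] discards the incompatible outcomes. *)
do 6 (case: ifP || case: (boolP (_ < _)%R)) => ?; try (exfalso; lia).
all: by rewrite ?addn0 ?addn1 ?exprS; ring.
Qed.

(** Inverse of standardization: absolute values are renumbered increasingly to avoid that of index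
    [h], and signs are kept. *)
Definition lift_letter {m : nat} (h : 'I_m.+1) (b : letter m) : letter m.+1 :=
  (lift h b.1, b.2).

Lemma lift_letter_inj (m : nat) (h : 'I_m.+1) : injective (@lift_letter m h).
Proof.
by move=> [i s] [j t] E; congr (_, _); [apply: lift_inj (congr1 fst E) | exact: (congr1 snd E)].
Qed.

Lemma lift_letter_lt (m : nat) (h : 'I_m.+1) (b c : letter m) :
  (letter_val (lift_letter h b) < letter_val (lift_letter h c))%R =
  (letter_val b < letter_val c)%R.
Proof.
case: b c => [i s] [j t]; rewrite /letter_val /=.
have := leq_bump2 h i j; have := leq_bump2 h j i.
by case: s; case: t => /=; lia.
Qed.

(** Handles the first position, where the comparison is with [w_0 = 0], which is not a lifted
    letter. *)
Lemma lift_letter_sign (m : nat) (h : 'I_m.+1) (b : letter m) :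
  ((letter_val (lift_letter h b) < 0)%R = (letter_val b < 0)%R).
Proof. by case: b => i []; rewrite /letter_val /=; lia. Qed.

Definition append_fun (m : nat) (a : letter m.+1) (v : {perm letter m})
    (x : letter m.+1) : letter m.+1 :=
  if unlift ord_max x.1 is Some j then lift_letter a.1 (v (j, x.2))
  else (a.1, a.2 (+) x.2).

Lemma append_fun_inj (m : nat) (a : letter m.+1) (v : {perm letter m}) :
  injective (append_fun a v).
Proof.
move=> [i s] [j t]; rewrite /append_fun /=.
case: unliftP => [i'|] ->; case: unliftP => [j'|] -> //.
- by move=> /lift_letter_inj/perm_inj[-> ->].
- by move=> /(congr1 fst) /= /eqP; rewrite eq_sym (negbTE (neq_lift _ _)).
- by move=> /(congr1 fst) /= /eqP; rewrite (negbTE (neq_lift _ _)).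
- by move=> [] /addbI->.
Qed.

(* The signed permutation with last letter [a] whose other letters standardize to [v]. *)
Definition append_letter (m : nat) (p : letter m.+1 * {perm letter m}) :
  {perm letter m.+1} := perm (@append_fun_inj m p.1 p.2).

Lemma append_letter_max (m : nat) (p : letter m.+1 * {perm letter m}) (s : bool) :
  append_letter p (ord_max, s) = (p.1.1, p.1.2 (+) s).
Proof. by rewrite permE /append_fun unlift_none. Qed.

Lemma append_letter_lift (m : nat) (p : letter m.+1 * {perm letter m}) j (s : bool) :
  append_letter p (lift ord_max j, s) = lift_letter p.1.1 (p.2 (j, s)).
Proof. by rewrite permE /append_fun liftK. Qed.

Lemma append_letter_inj (m : nat) : injective (@append_letter m).
Proof.
move=> [a v] [b u] E.
have ab : a = b.
  have := congr1 (fun w : {perm _} => w (ord_max, false)) E.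
  by rewrite !append_letter_max /= !addbF -!surjective_pairing.
subst b; congr (_, _); apply/permP => -[j s]; apply: (@lift_letter_inj _ a.1).
have := congr1 (fun w : {perm _} => w (lift ord_max j, s)) E.
by rewrite !append_letter_lift.
Qed.

Lemma append_letter_signed (m : nat) (a : letter m.+1) (v : {perm letter m}) :
  v \in signed_perms m -> append_letter (a, v) \in signed_perms m.+1.
Proof.
move=> /signed_permsP Hv; apply/signed_permsP => -[i s]; rewrite /letter_opp /=.
case: (unliftP ord_max i) => [j|] ->.
  by rewrite !append_letter_lift /= (Hv (j, s)).
by rewrite !append_letter_max /= addbN.
Qed.

(** Only the last position takes the absolute value of [a = w_n], so every other value is a lift
    along [a.1]; the lifted letters form the standardization [f]. *)
Lemma append_letter_surj (m : nat) (w : {perm letter m.+1}) :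
  w \in signed_perms m.+1 ->
  exists a, exists2 v, v \in signed_perms m & w = append_letter (a, v).
Proof.
move=> Hw; pose a := w (ord_max, false).
(* A sigma type rather than an existential, so that [f] can be extracted from it. *)
have liftP (x : letter m) :
    {b | w (lift ord_max x.1, x.2) = lift_letter a.1 b}.
  case E: (w _) => [i s]; case: (unliftP a.1 i) => [j Ei|Ei].
    by exists (j, s); rewrite Ei.
  have /(signed_perm_fst_inj Hw)/eqP : (w (lift ord_max x.1, x.2)).1 = a.1.
    by rewrite E.
  by rewrite /= eq_sym (negbTE (neq_lift _ _)).
pose f x := sval (liftP x).
have fE x : w (lift ord_max x.1, x.2) = lift_letter a.1 (f x) by apply: svalP (liftP x).
have f_inj : injective f.
  move=> [i s] [j t] E; have := fE (i, s); rewrite E -fE => /perm_inj E1.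
  by congr (_, _); [apply: lift_inj (congr1 fst E1) | exact: (congr1 snd E1)].
move/signed_permsP: (Hw) => Hopp.
exists a, (perm f_inj).
  apply/signed_permsP => x; rewrite !permE; apply: (@lift_letter_inj _ a.1).
  by rewrite -fE /= (Hopp (lift ord_max x.1, x.2)) fE.
apply/permP => -[i s]; case: (unliftP ord_max i) => [j|] ->.
  by rewrite append_letter_lift permE -fE.
rewrite append_letter_max /=; case: s; last by rewrite addbF -surjective_pairing.
by rewrite addbT (Hopp (ord_max, false)).
Qed.

Lemma prefix_des_append (m : nat) (a : letter m.+1) (v : {perm letter m}) :
  prefix_des m (append_letter (a, v)) = des v.
Proof.
rewrite des_prefix; apply: eq_bigr => i _; congr nat_of_bool.
have entry_append (k : 'I_m) :
    entry (append_letter (a, v)) k.+1 = letter_val (lift_letter a.1 (v (k, false))).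
  by rewrite -(lift_max k) entryE append_letter_lift.
rewrite entry_append entryE.
case: i => -[|i] lt_im /=; first exact: lift_letter_sign.
have := entry_append (Ordinal (ltnW lt_im)); rewrite /= => ->.
by have /= -> := entryE v (Ordinal (ltnW lt_im)); rewrite lift_letter_lt.
Qed.

(** Appending is a bijection from pairs [(a, v)], and the summand depends on [v] alone, so the
    [2 (m + 1)] choices of [a] factor out. *)
Lemma sum_prefix_des (m : nat) :
  \sum_(w in signed_perms m.+1) 'X^(prefix_des m w) =
  (2 * m.+1)%:R * eulerianC m :> {poly int}.
Proof.
have -> : signed_perms m.+1 = @append_letter m @: setX setT (signed_perms m).
  apply/setP => w; apply/idP/imsetP => [/append_letter_surj[a [v Hv ->]]|].
    by exists (a, v); rewrite // inE in_setT.
  by move=> [[a v]]; rewrite in_setX => /andP[_ Hv] ->; apply: append_letter_signed.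
rewrite big_imset /=; last by move=> p q _ _; apply: append_letter_inj.
rewrite (eq_bigl (fun p => (p.1 \in setT) && (p.2 \in signed_perms m))); last first.
  by move=> [a v]; rewrite in_setX.
rewrite (eq_bigr (fun p => 'X^(des p.2))); last first.
  by move=> [a v] _; rewrite prefix_des_append.
rewrite -(pair_big (mem setT) (mem (signed_perms m)) (fun _ v => 'X^(des v))) /=.
by rewrite sumr_const cardsT card_prod card_ord card_bool mulnC mulr_natl.
Qed.

Theorem proposition6p1 (n : nat) (hn : (2 <= n)%N) :
  2%:R * affine_eulerianC n =
  affine_eulerianB n + (2 * n)%:R * 'X * eulerianC n.-1.
Proof.
case: n hn => // m _ /=.
pose defect (w : {perm letter m.+1}) : {poly int} :=
  2%:R * 'X^(affine_desC w) - 'X^(affine_desB w).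
have two_neq0 : (2%:R : {poly int}) != 0 by rewrite -polyC_natr polyC_eq0.
suff E : \sum_(w in signed_perms m.+1) defect w = (2 * m.+1)%:R * 'X * eulerianC m.
  rewrite -E /defect sumrB -mulr_sumr /affine_eulerianC /affine_eulerianB.
  by rewrite addrC subrK.
(* Doubling the sum and reindexing one copy by [flip_last] pairs each [w] with its image. *)
apply: (mulfI two_neq0).
rewrite mulr2n mulrDl mul1r {2}(reindex_inj (inv_inj (@flip_lastK m))) /=.
rewrite (eq_bigl (mem (signed_perms m.+1)) _ (@flip_last_signed m)) -big_split /=.
rewrite (eq_bigr (fun w => 2%:R * ('X * 'X^(prefix_des m w)))); last first.
  by move=> w; apply: affine_defect_flip.
by rewrite -!mulr_sumr sum_prefix_des; ring.
Qed.
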